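(* Let $m,N\in\mathbb{N}$, let $n\in\{1,\dots,N\}$, and assume $r\ge 5/2$. Let $\delta:\mathbb{N}_0\to(0,\infty)$ be a function satisfying the following conditions for all $z\in\mathbb{N}=\{1,2,\dots\}$: (i) $z\,\delta(z)\le (z+1)\,\delta(z+1)$. (ii) If $z\ge 2$, then - $\delta(z)\le 2(m-3)$ implies $(m-6)\delta(z)+2(m-3)r\ge 0$, and - $\delta(z)>2(m-3)$ implies $n\{(m-6)\delta(z)+2(m-3)r\}\ge (z-1)\{\delta(z)-2(m-3)\}$. Then the shrinkage estimator $\hat p^{(\delta)}=(\hat p^{(\delta)}_{i,\nu})_{1\le i\le m,\,1\le\nu\le N}$ given by $$\hat p^{(\delta)}_{i,\nu}=\frac{X_{i,\nu}}{r+X_{\cdot,\nu}-1+\delta(X_{\cdot,\cdot})}\ \text{ if } X_{i,\nu}\ge 1,\qquad \hat p^{(\delta)}_{i,\nu}=0\ \text{ if } X_{i,\nu}=0,$$ dominates the UMVU estimator $\hat p^{\mathrm U}=(\hat p^{\mathrm U}_{i,\nu})$ given by $$\hat p^{\mathrm U}_{i,\nu}=\frac{X_{i,\nu}}{r+X_{\cdot,\nu}-1}\ \text{ if } X_{i,\nu}\ge 1,\qquad \hat p^{\mathrm U}_{i,\nu}=0\ \text{ if } X_{i,\nu}=0,$$ under the loss $$L_n(d,p)=\sum_{\nu=1}^{n}\sum_{i=1}^{m}\frac{1}{p_{i,\nu}}(d_{i,\nu}-p_{i,\nu})^2 .$$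
   Context: $\mathbb{N}=\{1,2,\dots\}$, $\mathbb{N}_0=\{0,1,2,\dots\}$. Let $D_m=\{(q_1,\dots,q_m)'\,:\,q_1,\dots,q_m>0,\ \sum_{i=1}^m q_i<1\}$. For $r>0$ and $q\in D_m$, with $q_0=1-\sum_{i=1}^m q_i$, the negative multinomial distribution $\mathrm{NM}_m(r,q)$ has probability mass function $$\mathrm{NM}_m(x\mid r,q)=\frac{\Gamma(r+\sum_{i=1}^m x_i)}{\Gamma(r)\prod_{i=1}^m x_i!}\,q_0^{\,r}\prod_{i=1}^m q_i^{x_i},\qquad x\in\mathbb{N}_0^m .$$ The observations $X_\nu=(X_{1,\nu},\dots,X_{m,\nu})'$, $\nu=1,\dots,N$, are independent with $X_\nu\sim\mathrm{NM}_m(r,p_\nu)$, where $r$ is known and $p=(p_1,\dots,p_N)\in D_m^N$, $p_\nu=(p_{1,\nu},\dots,p_{m,\nu})'$, is unknown. Put $X_{\cdot,\nu}=\sum_{i=1}^m X_{i,\nu}$ and $X_{\cdot,\cdot}=\sum_{\nu=1}^N X_{\cdot,\nu}$. The risk of an estimator $\hat p=\hat p(X)\in\mathbb{R}^{m\times N}$ under a loss $L$ is $E_p[L(\hat p,p)]$. An estimator $\hat p$ dominates $\hat p^*$ under $L$ if $E_p[L(\hat p,p)]\le E_p[L(\hat p^*,p)]$ for all $p\in D_m^N$, with strict inequality for at least one $p$. *)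

(* Defs.v *)
From HB Require Import structures.
From mathcomp Require Export all_boot all_order all_algebra.
From mathcomp Require Export all_classical all_reals all_analysis.
Export Order.TTheory GRing.Theory Num.Theory numFieldNormedType.Exports.

Set Implicit Arguments.
Unset Strict Implicit.
Unset Printing Implicit Defensive.

Local Open Scope classical_set_scope.
Local Open Scope ring_scope.

(* Euler's Gamma function; the integral is the usual one for s > 0. *)
Definition Gamma {R : realType} (s : R) : R :=
  Rintegral (@lebesgue_measure R) `]0, +oo[ (fun t : R => t `^ (s - 1) * expR (- t)).

Definition Dset (R : realType) (m : nat) : set 'cV[R]_m :=
  [set q : 'cV[R]_m | (forall i, 0 < q i ord0) /\ \sum_i q i ord0 < 1].
Arguments Dset : clear implicits.

Definition DsetN (R : realType) (m N : nat) : set 'M[R]_(m, N) :=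
  [set p : 'M[R]_(m, N) | forall nu, Dset R m (col nu p)].
Arguments DsetN : clear implicits.

Definition NM_pmf {R : realType} (m : nat) (r : R) (q : 'cV[R]_m)
    (x : 'cV[nat]_m) : R :=
  Gamma (r + (\sum_i x i ord0)%:R) / (Gamma r * \prod_i ((x i ord0)`!)%:R)
  * (1 - \sum_i q i ord0) `^ r * \prod_i q i ord0 ^+ x i ord0.

(* The countable space T carries its discrete sigma-algebra. *)
Definition discrete_measurable d (Omega : measurableType d) (T : Type)
    (Y : Omega -> T) : Prop :=
  forall A : set T, measurable (Y @^-1` A).

Definition has_NM_law {R : realType} d (Omega : measurableType d)
    (P : probability Omega R) (m : nat) (r : R) (q : 'cV[R]_m)
    (Y : Omega -> 'cV[nat]_m) : Prop :=
  discrete_measurable Y /\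
  forall x, P (Y @^-1` [set x]) = (NM_pmf r q x)%:E.

(* The product rule for a subfamily J is the case A i = setT for i outside J. *)
Definition mutually_independent {R : realType} d (Omega : measurableType d)
    (P : probability Omega R) (I : finType) (T : Type)
    (Y : I -> Omega -> T) : Prop :=
  forall A : I -> set T,
    P (\bigcap_(i in [set: I]) (Y i @^-1` A i)) =
    (\prod_(i : I) P (Y i @^-1` A i))%E.

Definition NM_sample {R : realType} d (Omega : measurableType d)
    (P : probability Omega R) (m N : nat) (r : R) (p : 'M[R]_(m, N))
    (X : Omega -> 'M[nat]_(m, N)) : Prop :=
  mutually_independent P (fun (nu : 'I_N) w => col nu (X w)) /\
  forall nu : 'I_N, has_NM_law P r (col nu p) (fun w => col nu (X w)).

Definition estimator (R : realType) (m N : nat) :=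
  'M[nat]_(m, N) -> 'M[R]_(m, N).

(* The risk may a priori be +oo. *)
Definition risk {R : realType} d (Omega : measurableType d) (m N : nat)
    (P : 'M[R]_(m, N) -> probability Omega R) (X : Omega -> 'M[nat]_(m, N))
    (L : 'M[R]_(m, N) -> 'M[R]_(m, N) -> R) (phat : estimator R m N)
    (p : 'M[R]_(m, N)) : \bar R :=
  'E_(P p)[fun w => L (phat (X w)) p].

Definition dominates {R : realType} d (Omega : measurableType d) (m N : nat)
    (P : 'M[R]_(m, N) -> probability Omega R) (X : Omega -> 'M[nat]_(m, N))
    (L : 'M[R]_(m, N) -> 'M[R]_(m, N) -> R) (phat phat' : estimator R m N) : Prop :=
  (forall p, DsetN R m N p -> (risk P X L phat p <= risk P X L phat' p)%E) /\
  (exists2 p, DsetN R m N p & (risk P X L phat p < risk P X L phat' p)%E).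

Definition col_total (m N : nat) (x : 'M[nat]_(m, N)) (nu : 'I_N) : nat :=
  (\sum_i x i nu)%N.

Definition total (m N : nat) (x : 'M[nat]_(m, N)) : nat :=
  (\sum_nu col_total x nu)%N.

Definition phat_U {R : realType} (m N : nat) (r : R) : estimator R m N :=
  fun x => \matrix_(i, nu)
    if (1 <= x i nu)%N then (x i nu)%:R / (r + (col_total x nu)%:R - 1) else 0.
Arguments phat_U {R} m N r.

Definition phat_shrink {R : realType} (m N : nat) (r : R) (delta : nat -> R) :
    estimator R m N :=
  fun x => \matrix_(i, nu)
    if (1 <= x i nu)%N
    then (x i nu)%:R / (r + (col_total x nu)%:R - 1 + delta (total x)) else 0.
Arguments phat_shrink {R} m N r delta.

(* Columns are indexed from 0: nu < n selects the first n of them. *)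
Definition loss {R : realType} (m N n : nat) (d p : 'M[R]_(m, N)) : R :=
  \sum_(nu < N | (nu < n)%N) \sum_(i < m) (p i nu)^-1 * (d i nu - p i nu) ^+ 2.
Arguments loss {R} m N n d p.

(* Main.v *)
Require Import Defs.
From mathcomp Require Import measurable_realfun ring lra.

(* Since NM_pmf r q (x + e_i) / NM_pmf r q x = q_i (r + x_.) / (x_i + 1), a sum
   over x of f(x) / q_i with f vanishing at x_i = 0 becomes a sum of shifted
   values of f free of q_i.  Expanding (d - p)^2 / p = d^2 / p - 2 d + p thus
   gives an unbiased estimate of the difference of the two risks, and it
   suffices to bound it for each x; the UMVU estimator is the case delta = 0.
   With s = r + x_., z the total of x and D = delta (z + 1), hypothesis (i) and
   r >= 5/2 bound the contribution of a column by
     - D ((m - 6) D + 2 (m - 3) r - x_. (D - 2 (m - 3))) / (s (s + D)^2),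
   and hypothesis (ii) makes the sum of these over the first n columns
   nonpositive, by Chebyshev's sum inequality.  At x = 0 the inequality is
   strict, so the risk inequality is strict for every p. *)

Set Implicit Arguments.
Unset Strict Implicit.
Unset Printing Implicit Defensive.
Local Open Scope classical_set_scope.
Local Open Scope ring_scope.

(** * Recurrence for the Gamma function *)

(** The exponential series gives exp t >= t^(k+1) / (k+1)! with an integer [k] above [s], so at t =
    n + 1 the product is at most (k+1)! / (n+1). *)
Lemma cvgn_powR_expRN (R : realType) (s : R) :
  n.+1%:R `^ s * expR (- n.+1%:R) @[n --> \oo] --> (0 : R).
Proof.
pose k := (Num.truncn `|s|).+1.
have sk : s <= k%:R by apply: le_trans (ler_norm s) _; exact: ltW (truncnS_gt _).
apply: (@squeeze_cvgr _ _ _ _ (fun=> 0) (fun n => k.+1`!%:R * harmonic n)).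
- apply: nearW => n /=; rewrite mulr_ge0 ?powR_ge0 ?expR_ge0//=.
  rewrite expRN ler_pdivrMr ?expR_gt0// -mulrA [leRHS]mulrC -ler_pdivrMr ?ltr0n ?fact_gt0//.
  rewrite ler_pdivlMl ?ltr0n//.
  have e0 := @expR_ge1Dxn R n.+1%:R k (ler0n _ _).
  apply: le_trans e0; rewrite ler_wpDl//.
  rewrite mulrA ler_wpM2r ?invr_ge0// exprS ler_wpM2l//.
  by rewrite -powR_mulrn// ler_powR// ler1n.
- exact: cvg_cst.
- by rewrite -[0](mulr0 k.+1`!%:R); apply: cvgM; [exact: cvg_cst|exact: cvg_harmonic].
Qed.

(** Integration by parts on [0, n + 1], then n tends to infinity. With 1 < s the derivative s
    t^(s-1) is continuous up to 0. *)
Lemma Gamma_add1 (R : realType) (s : R) : 1 < s -> Gamma (s + 1) = s * Gamma s.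
Proof.
move=> s1; have s0 : 0 < s by exact: lt_trans s1.
have sB0 : 0 < s - 1 by rewrite subr_gt0.
rewrite /Gamma /Rintegral.
pose f (t : R) : R := t `^ s * expR (- t).
pose g (t : R) : R := t `^ (s - 1) * expR (- t).
rewrite (addrK 1 s).
pose mu := @lebesgue_measure R.
have mf u : measurable_fun setT (fun t : R => t `^ u * expR (- t)).
  apply: measurable_funM => //.
  exact: (measurableT_comp (@measurable_expR R)).
(* Monotone convergence along growing intervals; adjoining the null endpoint 0 does not change the
   integral. *)
have cvgI u : (\int[mu]_(t in `[0%R, n.+1%:R]) (t `^ u * expR (- t))%:E)%E @[n --> \oo]
    --> (\int[mu]_(t in `]0%R, +oo[) (t `^ u * expR (- t))%:E)%E.
  rewrite integral_itv_obnd_cbnd; last exact/measurable_EFinP/measurable_funTS.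
  rewrite itv_bndy_bigcup_BRight; under eq_bigcupr do rewrite add0r.
  suff: (\int[mu]_(t in `[0%R, n%:R]) (t `^ u * expR (- t))%:E)%E @[n --> \oo]
    --> (\int[mu]_(t in \bigcup_n `[0%R, n%:R]%classic) (t `^ u * expR (- t))%:E)%E.
    by rewrite -cvg_shiftS.
  apply: ge0_nondecreasing_set_cvg_integral => //.
  - move=> a b ab; apply/subsetPset; apply: subset_itvl.
    by rewrite bnd_simp ler_nat.
  - by move=> i; apply/measurable_EFinP; exact: measurable_funS (mf u).
  - by move=> i x _; rewrite lee_fin mulr_ge0 ?powR_ge0 ?expR_ge0.
have cvgf := cvgI s; have cvgg := cvgI (s - 1).
have key n : (\int[mu]_(t in `[0%R, n.+1%:R]) (f t)%:E =
   s%:E * \int[mu]_(t in `[0%R, n.+1%:R]) (g t)%:E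
     - (n.+1%:R `^ s * expR (- n.+1%:R))%:E)%E.
  have n0 : 0 < n.+1%:R :> R by rewrite ltr0n.
  have dexpN (t : R) : is_derive t 1 (fun x => - expR (- x)) (expR (- t)).
    by apply: is_derive_eq; rewrite mulrN1 opprK.
  have cexpN : continuous (fun x : R => expR (- x)).
    by move=> x; apply: continuous_comp; [exact: opp_continuous|exact: continuous_expR].
  have cpow (u t : R) : 0 < t -> {for t, continuous (fun x : R => x `^ u)}.
    move=> t0; apply: differentiable_continuous.
    by apply/derivable1_diffP; apply: derivable_powR; rewrite in_itv/= t0.
  have powR0p (u : R) : 0 < u -> (fun x : R => x `^ u) x @[x --> 0^'+] --> 0 `^ u.
    by move=> u0; rewrite powR0 ?gt_eqF//; exact: powR_cvg0.
  rewrite (@integration_by_parts R (fun t => t `^ s) (fun t => - expR (- t))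
    (fun t => s * t `^ (s - 1)) (fun t => expR (- t)) 0 n.+1%:R n0).
  - rewrite /= powR0 ?gt_eqF// mul0r subr0.
    under [X in (_ - X)%E]eq_integral do rewrite mulrN EFinN -mulrA EFinM.
    rewrite integral_ge0N; last first.
      by move=> t _; rewrite mule_ge0// lee_fin ?mulr_ge0 ?powR_ge0 ?expR_ge0// ltW.
    rewrite ge0_integralZl//.
    + by rewrite oppeK mulrN EFinN addeC.
    + by apply/measurable_EFinP; exact: measurable_funS (mf (s - 1)).
    + by move=> t _; rewrite lee_fin mulr_ge0 ?powR_ge0 ?expR_ge0.
    + exact: ltW.
  - apply/continuous_within_itvP => //; split.
    + by move=> t /[!in_itv]/= /andP[t0 _]; apply: cvgM; [exact: cvg_cst|exact: cpow].
    + by apply: cvgM; [exact: cvg_cst|exact: powR0p].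
    + by apply: cvgM; [exact: cvg_cst|exact/cvg_at_left_filter/cpow].
  - split.
    + by move=> t /[!in_itv]/= /andP[t0 _]; apply: derivable_powR; rewrite in_itv/= t0.
    + exact: powR0p.
    + exact/cvg_at_left_filter/cpow.
  - move=> t /[!in_itv]/= /andP[t0 _].
    by rewrite powR_derive1// in_itv/= t0.
  - exact: continuous_subspaceT.
  - split.
    + move=> t _; exact: (@ex_derive _ _ _ _ _ _ _ (dexpN t)).
    + by apply: cvg_at_right_filter; apply: cvgN; exact: cexpN.
    + by apply: cvg_at_left_filter; apply: cvgN; exact: cexpN.
  - by move=> t _; rewrite derive1E; exact: derive_val.
(* [Rintegral] sends infinite values to 0, so an identity of extended integrals suffices: an
   infinite value would read 0 = s * 0. *)
suff -> : (\int[mu]_(t in `]0%R, +oo[) (f t)%:E = s%:E * \int[mu]_(t in `]0%R, +oo[) (g t)%:E)%E.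
  rewrite -/(g _); case: (\int[mu]_(t in `]0%R, +oo[) (g t)%:E)%E => [x| |] //=.
    by rewrite mulr0 gt0_muley ?lte_fin.
  by rewrite mulr0 gt0_muleNy ?lte_fin.
have cvgf' : (\int[mu]_(t in `[0%R, n.+1%:R]) (f t)%:E)%E @[n --> \oo]
    --> (s%:E * \int[mu]_(t in `]0%R, +oo[) (g t)%:E)%E.
  under eq_cvg do rewrite key.
  have c0 : (n.+1%:R `^ s * expR (- n.+1%:R))%:E @[n --> \oo] --> 0%:E.
    by apply: cvg_EFin; [exact: nearW|exact: cvgn_powR_expRN].
  rewrite -[(s%:E * _)%E]sube0; apply: cvgeB c0; first by rewrite fin_num_adde_defl.
  exact: cvgeZl.
exact: (cvg_unique (@ereal_hausdorff R) cvgf cvgf').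
Qed.

(** * Real inequalities *)

Section RealInequalities.
Variable R : realFieldType.
Implicit Types a b x z : R.

(** As x <= z, the hypothesis at [z] descends to x b <= (x + 1) b': multiply it by x and use x b' <=
    z b'. The left side of the claim is x b / (a (a + b)), and cross-multiplying leaves this
    inequality together with x b b' <= (x + 1) b b'. *)
Lemma shrink_gain_le a b b' x z : 0 < a -> 0 < b -> 0 < b' -> 0 <= x -> x <= z ->
  1 <= z -> z * b <= (z + 1) * b' ->
  x / a - x / (a + b) <= (x + 1) * b' / (a * (a + b')).
Proof.
move=> a0 b0 b'0 x0 xz z1 zb.
have xb : x * b <= (x + 1) * b'.
  have z0 : 0 < z by lra.
  rewrite -(ler_pM2l z0).
  have : x * (z * b) <= x * ((z + 1) * b') by rewrite ler_wpM2l.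
  have : 0 <= (z - x) * b' by rewrite mulr_ge0 ?subr_ge0// ltW.
  lra.
have -> : x / a - x / (a + b) = x * b / (a * (a + b)).
  by field; rewrite !gt_eqF// addr_gt0.
have ab := addr_gt0 a0 b0; have ab' := addr_gt0 a0 b'0.
rewrite ler_pdivrMr ?mulr_gt0// mulrAC ler_pdivlMr ?mulr_gt0//.
have -> : x * b * (a * (a + b')) = a * (a * (x * b) + x * b * b') by ring.
have -> : (x + 1) * b' * (a * (a + b)) = a * (a * ((x + 1) * b') + (x + 1) * b' * b) by ring.
rewrite ler_pM2l// lerD ?ler_pM2l//.
have : 0 < b * b' by rewrite mulr_gt0.
lra.
Qed.

(** The right side minus the left is x (2 r - 5) + 2 r^2 - 6 r + 3; the coefficient 2 r - 5 is the
    source of the bound 5/2. *)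
Lemma shift_ratio_le (r x : R) : 5%:R / 2%:R <= r -> 0 <= x ->
  (x + 1) * (r + x) ^+ 2 <= (x + 3%:R) * (r + x - 1) ^+ 2.
Proof.
move=> hr x0.
have : 0 <= x * (r - 5%:R / 2%:R) by rewrite mulr_ge0// subr_ge0.
nra.
Qed.

Lemma shift_ratio_le_add (r x b : R) : 5%:R / 2%:R <= r -> 0 <= x -> 0 < b ->
  (x + 1) * ((r + x) * (r + x + b)) <= (x + 3%:R) * ((r + x - 1) * (r + x - 1 + b)).
Proof.
move=> hr x0 b0; have h2 := shift_ratio_le hr x0.
have h1 : (x + 1) * (r + x) <= (x + 3%:R) * (r + x - 1) by nra.
have : b * ((x + 1) * (r + x)) <= b * ((x + 3%:R) * (r + x - 1)) by rewrite ler_pM2l.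
lra.
Qed.

(** One column with total [x], where [b] and [b'] stand for delta at z and z + 1. The squared terms
    gain (x + m) b' (2 s + b') / (s (s + b')^2), the linear terms lose at most 2 (x + 3) b' / (s (s
    + b')), and the third summand on the left is this gain minus this loss. *)
Lemma column_diff_le (m r x z b b' : R) (s := r + x) :
  5%:R / 2%:R <= r -> 0 <= x -> x <= z -> 1 <= z -> 0 < b -> 0 < b' ->
  z * b <= (z + 1) * b' ->
  (x + m) * s / (s + b') ^+ 2 + 2%:R * (x / (s - 1)) +
    b' * ((m - 6%:R) * b' + 2%:R * (m - 3%:R) * r - x * (b' - 2%:R * (m - 3%:R)))
      / (s * (s + b') ^+ 2)
  <= (x + m) / s + 2%:R * (x / (s - 1 + b)).
Proof.
move=> hr x0 xz z1 b0 b'0 zb.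
have s1 : 0 < s - 1 by rewrite /s; lra.
have s0 : 0 < s by lra.
have sb' : 0 < s + b' by lra.
have H1 := shrink_gain_le s1 b0 b'0 x0 xz z1 zb.
(* Trading s - 1 for [s] turns x + 1 into x + 3; this 3 produces the m - 3 and m - 6 of hypothesis
   (ii). *)
have H2 : (x + 1) * b' / ((s - 1) * (s - 1 + b')) <= (x + 3%:R) * b' / (s * (s + b')).
  have sb1' : 0 < s - 1 + b' by lra.
  rewrite ler_pdivrMr ?mulr_gt0// mulrAC ler_pdivlMr ?mulr_gt0//.
  have : b' * ((x + 1) * (s * (s + b'))) <= b' * ((x + 3%:R) * ((s - 1) * (s - 1 + b'))).
    by rewrite ler_pM2l//; exact: shift_ratio_le_add.
  lra.
have -> : (x + m) / s = (x + m) * s / (s + b') ^+ 2 +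
   (x + m) * b' * (2%:R * s + b') / (s * (s + b') ^+ 2).
  by field; rewrite !gt_eqF.
have E : b' * ((m - 6%:R) * b' + 2%:R * (m - 3%:R) * r - x * (b' - 2%:R * (m - 3%:R)))
      / (s * (s + b') ^+ 2) = (x + m) * b' * (2%:R * s + b') / (s * (s + b') ^+ 2)
   - 2%:R * ((x + 3%:R) * b' / (s * (s + b'))).
  by rewrite /s; field; rewrite -/s !gt_eqF.
rewrite E.
lra.
Qed.

(* Chebyshev's sum inequality against a decreasing weight: compare each weight
   with its value at the zero C / D of the linear factor. *)
Lemma weighted_linear_sum_ge0 (I : finType) (P : pred I) (x : I -> R) (w : R -> R)
    (C D : R) :
  (forall i, 0 <= x i) -> (forall u, 0 <= u -> 0 <= w u) ->
  (forall u v, 0 <= u -> u <= v -> w v <= w u) -> 0 <= C ->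
  (0 < D -> 0 <= \sum_(i | P i) (C - x i * D)) ->
  0 <= \sum_(i | P i) (C - x i * D) * w (x i).
Proof.
move=> x0 w0 w_anti C0 hD.
have [D0|D0] := ltP 0 D; last first.
  apply: sumr_ge0 => i _; rewrite mulr_ge0 ?w0// subr_ge0.
  by rewrite (le_trans _ C0)// mulr_ge0_le0.
apply: (@le_trans _ _ ((\sum_(i | P i) (C - x i * D)) * w (C / D))).
  by rewrite mulr_ge0 ?hD// w0// divr_ge0// ltW.
rewrite mulr_suml; apply: ler_sum => i _.
rewrite -subr_ge0 -mulrBr.
have [CD|CD] := leP (x i) (C / D).
  by rewrite mulr_ge0 ?subr_ge0 ?w_anti// -ler_pdivlMr.
rewrite mulr_le0// subr_le0; last by apply: w_anti => //; [rewrite divr_ge0// ltW|exact: ltW].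
by rewrite -ler_pdivrMr// ltW.
Qed.

End RealInequalities.

(** * Pointwise comparison of the integrands *)

Section Pointwise.
Context {R : realFieldType} (m N n : nat) (r : R).
Implicit Types (delta : nat -> R) (x : 'M[nat]_(m, N)) (nu : 'I_N).

(** The sum of the estimator's entries over the first [n] columns: up to the factor -2, the cross
    term of the expanded loss. *)
Definition sum_phat delta x : R :=
  \sum_(nu < N | (nu < n)%N)
    (col_total x nu)%:R / (r + (col_total x nu)%:R - 1 + delta (total x)).

(* The sum over i of E[d_i^2 / p_i] after the shift x -> x + e_i. *)
Definition shifted_square delta x : R :=
  \sum_(nu < N | (nu < n)%N)
    ((col_total x nu)%:R + m%:R) * (r + (col_total x nu)%:R) /
      (r + (col_total x nu)%:R + delta (total x).+1) ^+ 2.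

Lemma sum_col_total_le x : (\sum_(nu < N | (nu < n)%N) col_total x nu <= total x)%N.
Proof.
rewrite /total [leqRHS](bigID (fun nu : 'I_N => (nu < n)%N))/=; exact: leq_addr.
Qed.

Lemma col_total_le x nu : (col_total x nu <= total x)%N.
Proof. by rewrite /total (bigD1 nu)//= leq_addr. Qed.

(** At the zero matrix the linear terms vanish, and delta(1) > 0 strictly enlarges the denominators
    of the squared terms. Hypothesis (i) starts at z = 1, so this case stands apart. *)
Lemma shifted_square_total0_lt delta x : 5%:R / 2%:R <= r -> (1 <= m)%N -> (1 <= n <= N)%N ->
  (forall z, 0 < delta z) -> total x = 0%N ->
  shifted_square delta x + 2%:R * sum_phat (fun=> 0) x
    < shifted_square (fun=> 0) x + 2%:R * sum_phat delta x.
Proof.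
move=> hr hm hn dp tx.
have c0 nu : col_total x nu = 0%N by apply/eqP; rewrite -leqn0 -tx col_total_le.
have s0 e : sum_phat e x = 0 by apply: big1 => nu _; rewrite c0 mul0r.
rewrite !s0 !mulr0 !addr0 /shifted_square.
case/andP: hn => n0 nN.
have N0 : (0 < N)%N by exact: leq_trans nN.
apply: ltr_sum; first by apply/hasP; exists (Ordinal N0); rewrite ?mem_index_enum.
move=> nu _; rewrite c0 !addr0 add0r tx.
have r0 : 0 < r by apply: lt_le_trans hr; rewrite divr_gt0.
have d1 := dp 1%N.
rewrite ltr_pM2l ?mulr_gt0 ?ltr0n// ltf_pV2 ?posrE ?exprn_gt0 ?addr_gt0//.
by rewrite ltrXn2r ?nnegrE ?ltW ?addr_gt0// ltrDl.
Qed.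

Lemma shifted_square_le delta x : 5%:R / 2%:R <= r -> (n <= N)%N ->
  (forall z, 0 < delta z) ->
  (forall z : nat, (1 <= z)%N -> z%:R * delta z <= (z.+1)%:R * delta z.+1) ->
  (forall z : nat, (2 <= z)%N ->
       (delta z <= 2%:R * (m%:R - 3%:R) ->
          0 <= (m%:R - 6%:R) * delta z + 2%:R * (m%:R - 3%:R) * r) /\
       (2%:R * (m%:R - 3%:R) < delta z ->
          (z%:R - 1) * (delta z - 2%:R * (m%:R - 3%:R)) <=
          n%:R * ((m%:R - 6%:R) * delta z + 2%:R * (m%:R - 3%:R) * r))) ->
  (0 < total x)%N ->
  shifted_square delta x + 2%:R * sum_phat (fun=> 0) x
    <= shifted_square (fun=> 0) x + 2%:R * sum_phat delta x.
Proof.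
move=> hr nN dp di dii tx0.
set z := total x in tx0 *; set b' := delta z.+1.
pose C := (m%:R - 6%:R) * b' + 2%:R * (m%:R - 3%:R) * r.
pose D := b' - 2%:R * (m%:R - 3%:R).
pose c nu : R := (col_total x nu)%:R.
pose w u := b' / ((r + u) * (r + u + b') ^+ 2).
have b'0 : 0 < b' := dp _.
(* Hypothesis (ii) is applied at z + 1 >= 2, so its factor z - 1 becomes the present total. *)
have [dl du] := dii z.+1 tx0.
have [n0|n0] := posnP n.
  by rewrite /shifted_square /sum_phat !big_pred0 ?mulr0// => nu; rewrite n0.
have Dz : 0 < D -> z%:R * D <= n%:R * C.
  by rewrite /D subr_gt0 => /du; rewrite -natr1 addrK.
(* If D <= 0 this is the first half of (ii); otherwise the second half gives n C >= z D >= 0. *)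
have C0 : 0 <= C.
  have [/dl//|/[dup] D0 /du] := leP b' (2%:R * (m%:R - 3%:R)).
  rewrite -natr1 addrK => H; rewrite -(@pmulr_rge0 _ n%:R) ?ltr0n//.
  by apply: le_trans H; rewrite mulr_ge0// subr_ge0 ltW.
have wpos : 0 <= \sum_(nu < N | (nu < n)%N) (C - c nu * D) * w (c nu).
  apply: weighted_linear_sum_ge0 => //.
  - by move=> u u0; rewrite /w divr_ge0 ?mulr_ge0 ?exprn_ge0//; lra.
  - move=> u v u0 uv; rewrite /w ler_pM2l// lef_pV2 ?posrE ?mulr_gt0 ?exprn_gt0//; try lra.
    apply: ler_pM; rewrite ?exprn_ge0 ?lerXn2r ?nnegrE//; lra.
  (* The sum is n C minus D times the total of the first [n] columns, which is at most z. *)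
  - move=> D0; rewrite big_split/= sumrN -mulr_suml subr_ge0.
    rewrite -(big_ord_widen _ (fun=> C) nN) sumr_const card_ord -mulr_natl; apply: le_trans (Dz D0).
    by rewrite (ler_wpM2r (ltW D0))// /c -natr_sum ler_nat sum_col_total_le.
rewrite /shifted_square /sum_phat !mulr_sumr -!big_split/=.
(* Adding the nonnegative weighted sum to the left side reduces the claim to [column_diff_le] in
   each column. *)
rewrite -[leLHS]addr0; apply: le_trans (lerD (lexx _) wpos) _.
rewrite -big_split/=; apply: ler_sum => nu _; rewrite -/z.
have cnu0 : 0 <= c nu by exact: ler0n.
have s0 : 0 < r + c nu by lra.
have cz : c nu <= z%:R by rewrite ler_nat col_total_le.
have z1 : 1 <= z%:R :> R by rewrite ler1n.
have := @column_diff_le R m%:R r (c nu) z%:R (delta z) b' hr (ler0n _ _) cz z1 (dp z) b'0.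
have := di z tx0; rewrite -[z.+1%:R]natr1 => diz /(_ diz).
rewrite !addr0 /w -/(c nu) -/b' -/C -/D.
rewrite (_ : (c nu + m%:R) * (r + c nu) / (r + c nu) ^+ 2 = (c nu + m%:R) / (r + c nu)); last first.
  by field; rewrite gt_eqF.
lra.
Qed.
End Pointwise.

(** * Shifting one observation *)

(** Raising x_i by one multiplies the Gamma factor by r + x_. through [Gamma_add1], the factorial by
    x_i + 1 and the power by q_i. *)
Lemma NM_pmf_succ (R : realType) (m : nat) (r : R) (q : 'cV[R]_m) (i : 'I_m)
    (x y : 'cV[nat]_m) : 1 < r ->
  y i ord0 = (x i ord0).+1 -> (forall j, j != i -> y j ord0 = x j ord0) ->
  NM_pmf r q y * (x i ord0).+1%:R =
    q i ord0 * (r + (\sum_j x j ord0)%:R) * NM_pmf r q x.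
Proof.
move=> r1 yi yj.
have E (z : 'cV[nat]_m) : (forall j, j != i -> z j ord0 = x j ord0) ->
    NM_pmf r q z = Gamma (r + (z i ord0 + \sum_(j | j != i) x j ord0)%:R) /
    (Gamma r * ((z i ord0)`!%:R * \prod_(j | j != i) (x j ord0)`!%:R))
    * (1 - \sum_j q j ord0) `^ r
    * (q i ord0 ^+ z i ord0 * \prod_(j | j != i) q j ord0 ^+ x j ord0).
  move=> zx; rewrite /NM_pmf.
  have -> : (\sum_j z j ord0)%N = (z i ord0 + \sum_(j | j != i) x j ord0)%N.
    by rewrite (bigD1 i)//= (eq_bigr _ zx).
  have -> : \prod_j (z j ord0)`!%:R =
      (z i ord0)`!%:R * \prod_(j | j != i) (x j ord0)`!%:R :> R.
    by rewrite (bigD1 i)//=; congr *%R; apply: eq_bigr => j /zx ->.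
  congr (_ * _); rewrite (bigD1 i)//=; congr *%R.
  by apply: eq_bigr => j /zx ->.
rewrite !E// yi addSn.
have -> : (\sum_j x j ord0)%N = (x i ord0 + \sum_(j | j != i) x j ord0)%N by rewrite (bigD1 i).
rewrite -natr1 addrA Gamma_add1; last by rewrite (lt_le_trans r1)// lerDl.
rewrite factS natrM exprS !invfM.
have x0 : (x i ord0).+1%:R != 0 :> R by rewrite pnatr_eq0.
move: (Gamma r)^-1 (_ `^ r) (Gamma (_ + _)) => a b c.
move: (\prod_(j | j != i) (x j ord0)`!%:R)^-1 (\prod_(j | j != i) q j ord0 ^+ x j ord0) => d e.
move: ((x i ord0)`!%:R)^-1 => f.
by field.
Qed.

Section Law.
Context {m N : nat}.
Implicit Types (x : 'M[nat]_(m, N)).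

Definition incr (i : 'I_m) (nu : 'I_N) x : 'M[nat]_(m, N) :=
  \matrix_(j, k) (x j k + ((j == i) && (k == nu)))%N.

Lemma incrE i nu x : incr i nu x i nu = (x i nu).+1.
Proof. by rewrite mxE !eqxx addn1. Qed.

Lemma incr_neq i nu x j k : (j, k) != (i, nu) -> incr i nu x j k = x j k.
Proof. by rewrite mxE xpair_eqE => /negPf ->; rewrite addn0. Qed.

Lemma col_total_incr i nu x k :
  col_total (incr i nu x) k = (col_total x k + (k == nu))%N.
Proof.
rewrite /col_total (eq_bigr (fun j => x j k + ((j == i) && (k == nu)))%N); last first.
  by move=> j _; rewrite mxE.
rewrite big_split/=; congr addn.
case: (k == nu); last by rewrite big1// => j _; rewrite andbF.
by rewrite (bigD1 i)//= eqxx big1// => j /negPf ->.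
Qed.

Lemma total_incr i nu x : total (incr i nu x) = (total x).+1.
Proof.
rewrite /total (eq_bigr _ (fun k _ => col_total_incr i nu x k)) big_split/=.
rewrite -[RHS]addn1; congr addn.
by rewrite (bigD1 nu)//= eqxx big1// => j /negPf ->.
Qed.

Lemma incr_bij i nu :
  set_bij [set: 'M[nat]_(m, N)] [set x : 'M[nat]_(m, N) | (0 < x i nu)%N] (incr i nu).
Proof.
split.
- by move=> x _ /=; rewrite incrE.
- move=> x y _ _ xy; apply/matrixP => j k.
  by move/matrixP: xy => /(_ j k); rewrite !mxE => /addIn.
- move=> x /= x0; exists (\matrix_(j, k) (x j k - ((j == i) && (k == nu)))%N) => //.
  apply/matrixP => j k; rewrite !mxE subnK//.
  by case: eqP => [->|]//; case: eqP => [->|].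
Qed.

Definition sample_pmf {R : realType} (r : R) (p : 'M[R]_(m, N)) x : R :=
  \prod_nu NM_pmf r (col nu p) (col nu x).

Lemma sample_pmf_incr {R : realType} (r : R) (p : 'M[R]_(m, N)) i nu x : 1 < r ->
  sample_pmf r p (incr i nu x) * (x i nu).+1%:R =
  p i nu * (r + (col_total x nu)%:R) * sample_pmf r p x.
Proof.
move=> r1; rewrite /sample_pmf (bigD1 nu)//= [in RHS](bigD1 nu)//=.
have -> : \prod_(k | k != nu) NM_pmf r (col k p) (col k (incr i nu x)) =
    \prod_(k | k != nu) NM_pmf r (col k p) (col k x).
  apply: eq_bigr => k knu; congr NM_pmf; apply/matrixP => j l; rewrite [LHS]mxE [RHS]mxE.
  by rewrite incr_neq// xpair_eqE negb_and knu orbT.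
have := @NM_pmf_succ R m r (col nu p) i (col nu x) (col nu (incr i nu x)) r1.
rewrite !mxE !eqxx addn1.
have -> : (\sum_j col nu x j ord0)%N = col_total x nu.
  by apply: eq_bigr => j _; rewrite mxE.
move=> /(_ erefl) H; rewrite mulrAC H; last first.
  by move=> j ji; rewrite !mxE (negPf ji) addn0.
by rewrite !mulrA.
Qed.
End Law.

(** * Integrals of functions of a discrete random variable *)

Section DiscreteIntegral.
Context d (Omega : measurableType d) {R : realType} (P : probability Omega R).
Context {T : countType} (Y : Omega -> T).

(** As [T] is countable, every preimage is a countable union of fibres, indexed here by the codes of
    [pickle]. *)
Lemma discrete_measurable_preimage1 :
  (forall t, measurable (Y @^-1` [set t])) -> discrete_measurable Y.
Proof.
move=> mY A.
have -> : Y @^-1` A = \bigcup_k (if unpickle k is Some t then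
    if t \in A then Y @^-1` [set t] else set0 else set0).
  apply/seteqP; split=> [w Aw|w [k _]].
    by exists (pickle (Y w)) => //=; rewrite pickleK mem_set.
  case: unpickle => // t; case: ifPn => // /set_mem At /= ->.
  exact: At.
apply: bigcupT_measurable => k; case: unpickle => // t.
by case: ifP.
Qed.

Hypothesis mY : discrete_measurable Y.

Lemma discrete_measurable_fun (f : T -> \bar R) :
  measurable_fun [set: Omega] (f \o Y).
Proof. by move=> _ B _; rewrite setTI comp_preimage; exact: mY. Qed.

(** [Omega] splits into countably many fibres of [Y], on each of which the integrand is constant;
    nonnegativity permits infinite values. *)
Lemma integral_discrete (f : T -> R) : (forall t, 0 <= f t) ->
  (\int[P]_w (f (Y w))%:E =
   \esum_(t in [set: T]) ((f t)%:E * P (Y @^-1` [set t])))%E.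
Proof.
move=> f0.
pose F k := Y @^-1` [set t | pickle t = k].
have tF : trivIset [set: nat] F by apply: trivIset_preimage1.
have UF : [set: Omega] = \bigcup_k F k.
  by apply/seteqP; split => // w _; exists (pickle (Y w)).
rewrite [in LHS]UF ge0_integral_bigcup//; last first.
- by move=> w _; rewrite lee_fin.
- by apply: measurable_funS measurableT _ (discrete_measurable_fun (EFin \o f)).
- by move=> k; exact: mY.
rewrite nneseries_esumT; last first.
  by move=> k; apply: integral_ge0 => w _; rewrite lee_fin.
rewrite (esumID (range (@pickle T))); last first.
  by move=> k _; apply: integral_ge0 => w _; rewrite lee_fin.
(* Integers that are not codes have an empty fibre. *)
rewrite [X in (_ + X)%E]esum1 ?adde0 ?setTI; last first.
  move=> k /= nk; rewrite (_ : F k = set0) ?integral_set0//.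
  by rewrite -subset0 => w /= kw; apply: nk; exists (Y w).
rewrite (reindex_esum [set: T] _ (@pickle T)); last first.
  by split => [t _|x y _ _|_ [t _ <-]] /=; [exists t|exact: (pcan_inj pickleK)|exists t].
apply: eq_esum => t _.
have -> : F (pickle t) = Y @^-1` [set t].
  apply/seteqP; split => w; last by rewrite /F/= => ->.
  exact: (pcan_inj pickleK).
rewrite (eq_integral (fun=> (f t)%:E)) ?integral_cst//.
by move=> w /set_mem/= ->.
Qed.

Lemma integral_discreteD (f g : T -> R) :
  (forall t, 0 <= f t) -> (forall t, 0 <= g t) ->
  (\int[P]_w (f (Y w) + g (Y w))%:E =
   \int[P]_w (f (Y w))%:E + \int[P]_w (g (Y w))%:E)%E.
Proof.
move=> f0 g0; under eq_integral do rewrite EFinD.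
rewrite ge0_integralD//.
- by move=> w _; rewrite lee_fin.
- exact: (discrete_measurable_fun (EFin \o f)).
- by move=> w _; rewrite lee_fin.
- exact: (discrete_measurable_fun (EFin \o g)).
Qed.

Lemma integral_discrete_sum (I : Type) (s : seq I) (Q : pred I) (f : I -> T -> R) :
  (forall i t, Q i -> 0 <= f i t) ->
  (\int[P]_w (\sum_(i <- s | Q i) f i (Y w))%:E =
   \sum_(i <- s | Q i) \int[P]_w (f i (Y w))%:E)%E.
Proof.
move=> f0; elim: s => [|i s IH].
  by under eq_integral do rewrite big_nil; rewrite big_nil integral0.
rewrite big_cons; under eq_integral do rewrite big_cons.
have [Qi|_] := boolP (Q i); last exact: IH.
rewrite -IH -(@integral_discreteD (f i) (fun t => \sum_(j <- s | Q j) f j t))//.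
  by move=> t; exact: f0.
by move=> t; apply: sumr_ge0 => j; exact: f0.
Qed.

Lemma integral_discrete_fin_num (f : T -> R) (M : R) :
  (forall t, 0 <= f t <= M) -> (\int[P]_w (f (Y w))%:E)%E \is a fin_num.
Proof.
move=> fM; rewrite ge0_fin_numE; last first.
  by apply: integral_ge0 => w _; rewrite lee_fin; have /andP[] := fM (Y w).
apply: (@le_lt_trans _ _ (\int[P]_w M%:E)%E).
  apply: ge0_le_integral => //.
  - by move=> w _; rewrite lee_fin; have /andP[] := fM (Y w).
  - exact: (discrete_measurable_fun (EFin \o f)).
  - by move=> w _; rewrite lee_fin; have /andP[] := fM (Y w).
rewrite integral_cst// [X in (_ * X)%E](_ : _ = 1%E) ?mule1 ?ltry//.
exact: probability_setT.
Qed.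

(** The integral of g - f is at least the positive contribution of the atom [t]. The bound [M] makes
    the integral of [f] finite, so that adding this contribution is strict. *)
Lemma integral_discrete_lt (f g : T -> R) (M : R) (t : T) :
  (forall u, 0 <= f u) -> (forall u, f u <= g u <= M) -> f t < g t ->
  (0 < P (Y @^-1` [set t]))%E ->
  (\int[P]_w (f (Y w))%:E < \int[P]_w (g (Y w))%:E)%E.
Proof.
move=> f0 fgM fgt Pt.
have fg u : f u <= g u by have /andP[] := fgM u.
have -> : (\int[P]_w (g (Y w))%:E =
    \int[P]_w (f (Y w))%:E + \int[P]_w (g (Y w) - f (Y w))%:E)%E.
  rewrite -(@integral_discreteD f (fun u => g u - f u))//; last first.
    by move=> u; rewrite subr_ge0.
  by apply: eq_integral => w _; rewrite addrC subrK.
rewrite lteDl; last first.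
  apply: (@integral_discrete_fin_num f M) => u; rewrite f0/=.
  by have /andP[+ gM] := fgM u; move=> /le_trans; apply.
rewrite (integral_discrete (f := fun u => g u - f u)); last by move=> u; rewrite subr_ge0.
apply: (@lt_le_trans _ _ ((g t - f t)%:E * P (Y @^-1` [set t]))%E).
  by rewrite mule_gt0// lte_fin subr_gt0.
apply: esum_ge; exists [set t]; first by split => //; exact: finite_set1.
by rewrite fsbig_set1.
Qed.

End DiscreteIntegral.

(** * Law of the sample and risk *)

Section Sample.
Context {R : realType} {d} {Omega : measurableType d} (P : probability Omega R).
Context {m N : nat} (r : R) (p : 'M[R]_(m, N)) (X : Omega -> 'M[nat]_(m, N)).
Hypothesis sX : NM_sample P r p X.

Lemma sample_preimage1 x :
  X @^-1` [set x] = \bigcap_(nu in [set: 'I_N]) ((fun w => col nu (X w)) @^-1` [set col nu x]).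
Proof.
apply/seteqP; split=> [w /= wx nu _ /=|w /= wx].
  by rewrite wx.
apply/matrixP => i nu; have /matrixP/(_ i ord0) := wx nu I.
by rewrite !mxE.
Qed.

Lemma sample_measurable : discrete_measurable X.
Proof.
apply: discrete_measurable_preimage1 => x; rewrite sample_preimage1.
apply: fin_bigcap_measurable => // nu _; exact: (sX.2 nu).1.
Qed.

Lemma sample_law x : P (X @^-1` [set x]) = (sample_pmf r p x)%:E.
Proof.
rewrite sample_preimage1 sX.1 /sample_pmf -prodEFin; apply: eq_bigr => nu _.
exact: (sX.2 nu).2.
Qed.

Lemma sample_pmf_ge0 x : 0 <= sample_pmf r p x.
Proof. by rewrite -lee_fin -sample_law. Qed.

Lemma sample_pmf0_gt0 : DsetN R m N p -> (0 < N)%N -> 0 < sample_pmf r p 0.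
Proof.
move=> Dp N0.
(* Gamma r = 0 is excluded indirectly: as the inverse of 0 is 0, every probability would vanish,
   against total mass one. *)
have [G0|G0] := eqVneq (Gamma r) 0; last first.
  rewrite lt0r sample_pmf_ge0 andbT; apply/prodf_neq0 => nu _.
  have c0 i : col nu (0 : 'M[nat]_(m, N)) i ord0 = 0%N by rewrite !mxE.
  rewrite /NM_pmf [X in Gamma (r + X%:R)]big1// addr0.
  rewrite [X in _ / (_ * X)]big1 ?mulr1 => [|i _]; last by rewrite c0.
  rewrite [X in _ * X]big1 ?mulr1 => [|i _]; last by rewrite c0.
  rewrite divff// mul1r gt_eqF// powR_gt0// subr_gt0.
  by have [] := Dp nu.
have pmf0 x : sample_pmf r p x = 0.
  rewrite /sample_pmf (bigD1 (Ordinal N0))//= /NM_pmf G0.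
  by rewrite !(mul0r, invr0, mulr0).
have := integral_discrete P sample_measurable (f := fun=> 1) (fun=> ler01).
rewrite esum1; last by move=> x _; rewrite sample_law pmf0 mule0.
rewrite integral_cst// mul1e => H.
have := @probability_setT _ _ _ P; rewrite [X in X = _ -> _]H => /eqP.
by rewrite lt_eqF// lte01.
Qed.

(** The shift identity: since [f] vanishes where the entry is 0, the sum runs over positive entries,
    is reindexed by [incr], and the recurrence of the mass function cancels the unknown p. *)
Lemma integral_sample_div i nu (f : 'M[nat]_(m, N) -> R) : 1 < r ->
  0 < p i nu -> (forall x, 0 <= f x) -> (forall x : 'M[nat]_(m, N), x i nu = 0%N -> f x = 0) ->
  (\int[P]_w (f (X w) / p i nu)%:E =
   \int[P]_w (f (incr i nu (X w)) *
      ((r + (col_total (X w) nu)%:R) / (X w i nu).+1%:R))%:E)%E.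
Proof.
move=> r1 p0 f0 fx0.
have r0 : 0 < r by exact: lt_trans r1.
have mX := sample_measurable.
rewrite (integral_discrete P mX (f := fun x => f x / p i nu)); last first.
  by move=> x; rewrite divr_ge0// ltW.
rewrite (integral_discrete P mX (f := fun x => f (incr i nu x) *
      ((r + (col_total x nu)%:R) / (x i nu).+1%:R))); last first.
  by move=> x; rewrite mulr_ge0// divr_ge0// addr_ge0// ltW.
rewrite (esumID [set x : 'M[nat]_(m, N) | (0 < x i nu)%N]); last first.
  by move=> x _; rewrite mule_ge0// lee_fin divr_ge0// ltW.
rewrite !setTI [X in (_ + X)%E]esum1 ?adde0; last first.
  by move=> x /= /negP; rewrite -leqNgt leqn0 => /eqP/fx0 ->; rewrite mul0r mul0e.
rewrite (reindex_esum _ _ _ _ (incr_bij i nu)); apply: eq_esum => x _.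
rewrite !sample_law -!EFinM; congr EFin.
have x0 : (x i nu).+1%:R != 0 :> R by rewrite pnatr_eq0.
apply: (mulIf x0); rewrite -mulrA sample_pmf_incr//.
by move: (_.+1%:R) x0 => u u0; field; rewrite u0 gt_eqF.
Qed.

End Sample.

Section Risk.
Context {R : realType} {m N : nat} (n : nat) (r : R).
Implicit Types (delta : nat -> R) (x : 'M[nat]_(m, N)) (p : 'M[R]_(m, N)).

Lemma phat_shrinkE delta x i nu : phat_shrink m N r delta x i nu =
  (x i nu)%:R / (r + (col_total x nu)%:R - 1 + delta (total x)).
Proof. by rewrite mxE; case: (x i nu) => //; rewrite mul0r. Qed.

Lemma phat_UE : phat_U m N r = phat_shrink m N r (fun=> 0).
Proof. by apply/funext => x; apply/matrixP => i nu; rewrite !mxE addr0. Qed.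

Lemma sum_phatE delta x : sum_phat n r delta x =
  \sum_(nu < N | (nu < n)%N) \sum_i phat_shrink m N r delta x i nu.
Proof.
apply: eq_bigr => nu _; rewrite (eq_bigr _ (fun i _ => phat_shrinkE delta x i nu)).
by rewrite -mulr_suml natr_sum.
Qed.

(** The cross term stands on the left so that every term is nonnegative and integrals add in the
    extended reals. *)
Lemma loss_expand delta x p : DsetN R m N p ->
  loss m N n (phat_shrink m N r delta x) p + 2%:R * sum_phat n r delta x =
  \sum_(nu < N | (nu < n)%N) \sum_i (phat_shrink m N r delta x i nu ^+ 2 / p i nu)
  + \sum_(nu < N | (nu < n)%N) \sum_i p i nu.
Proof.
move=> Dp; rewrite sum_phatE /loss mulr_sumr -!big_split/=; apply: eq_bigr => nu _.
rewrite mulr_sumr -!big_split/=; apply: eq_bigr => i _.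
have : 0 < p i nu by have [/(_ i)] := Dp nu; rewrite mxE.
by move=> /lt0r_neq0 p0; field.
Qed.

Lemma loss_ge0 (q p : 'M[R]_(m, N)) : DsetN R m N p -> 0 <= loss m N n q p.
Proof.
move=> Dp; apply: sumr_ge0 => nu _; apply: sumr_ge0 => i _.
by rewrite mulr_ge0 ?sqr_ge0// invr_ge0; have [/(_ i)] := Dp nu; rewrite mxE => /ltW.
Qed.

(** As r > 1, each column contributes a ratio in [0, 1]; the cross term therefore has finite
    expectation. *)
Lemma sum_phat_bounds delta x : 1 < r -> (forall z, 0 <= delta z) ->
  0 <= sum_phat n r delta x <= \sum_(nu < N | (nu < n)%N) 1.
Proof.
move=> r1 d0; have dz := d0 (total x); apply/andP; split.
  by apply: sumr_ge0 => nu _; have c0 := ler0n R (col_total x nu); rewrite divr_ge0//; lra.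
apply: ler_sum => nu _; have c0 := ler0n R (col_total x nu).
by rewrite ler_pdivrMr; lra.
Qed.

Lemma shifted_square_ge0 delta x : 0 < r -> 0 <= shifted_square n r delta x.
Proof.
move=> r0; apply: sumr_ge0 => nu _.
by rewrite divr_ge0 ?sqr_ge0// mulr_ge0 ?addr_ge0// ltW.
Qed.

Lemma shifted_square0_le x : 1 < r ->
  shifted_square n r (fun=> 0) x <= \sum_(nu < N | (nu < n)%N) (m%:R + 1).
Proof.
move=> r1; apply: ler_sum => nu _; rewrite addr0.
have c0 := ler0n R (col_total x nu); have m0 := ler0n R m.
have s0 : 0 < r + (col_total x nu)%:R by lra.
rewrite expr2 invfM mulrA mulfK ?gt_eqF// ler_pdivrMr//.
have : 0 <= m%:R * (r + (col_total x nu)%:R - 1) by rewrite mulr_ge0//; lra.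
lra.
Qed.

Context {d} {Omega : measurableType d}.
Variables (P : 'M[R]_(m, N) -> probability Omega R) (X : Omega -> 'M[nat]_(m, N)).

(** The unbiased risk estimate, stated without subtraction because the risk may a priori be
    infinite. *)
Lemma risk_shrinkD delta p : DsetN R m N p -> NM_sample (P p) r p X ->
  1 < r -> (forall z, 0 <= delta z) ->
  (risk P X (loss m N n) (phat_shrink m N r delta) p
     + \int[P p]_w (2%:R * sum_phat n r delta (X w))%:E =
   \int[P p]_w (shifted_square n r delta (X w))%:E
     + (\sum_(nu < N | (nu < n)%N) \sum_i p i nu)%:E)%E.
Proof.
move=> Dp sX r1 d0; have mX := sample_measurable sX.
have p0 i nu : 0 < p i nu by have [/(_ i)] := Dp nu; rewrite mxE.
have r0 : 0 < r by lra.
have sp0 x : 0 <= 2%:R * sum_phat n r delta x.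
  by rewrite mulr_ge0//; have /andP[] := sum_phat_bounds x r1 d0.
rewrite /risk unlock.
rewrite -(integral_discreteD (P p) mX
  (f := fun x => loss m N n (phat_shrink m N r delta x) p)
  (g := fun x => 2%:R * sum_phat n r delta x))//; last first.
  by move=> x; exact: loss_ge0.
under eq_integral do rewrite loss_expand//.
rewrite (integral_discreteD (P p) mX
  (f := fun x => \sum_(nu < N | (nu < n)%N)
           \sum_i (phat_shrink m N r delta x i nu ^+ 2 / p i nu))
  (g := fun=> \sum_(nu < N | (nu < n)%N) \sum_i p i nu)); last 2 first.
- move=> x; apply: sumr_ge0 => nu _; apply: sumr_ge0 => i _.
  by rewrite divr_ge0 ?sqr_ge0// ltW.
- by move=> _; apply: sumr_ge0 => nu _; apply: sumr_ge0 => i _; exact: ltW.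
congr (_ + _)%E; last first.
  by rewrite integral_cst// [X in (_ * X)%E](_ : _ = 1%E) ?mule1//; exact: probability_setT.
have q0 i nu x : 0 <= (x i nu).+1%:R * (r + (col_total x nu)%:R) /
      (r + (col_total x nu)%:R + delta (total x).+1) ^+ 2.
  by rewrite divr_ge0 ?sqr_ge0// mulr_ge0// addr_ge0// ltW.
transitivity (\sum_(nu < N | (nu < n)%N) \sum_i
    \int[P p]_w ((X w i nu).+1%:R * (r + (col_total (X w) nu)%:R) /
      (r + (col_total (X w) nu)%:R + delta (total (X w)).+1) ^+ 2)%:E)%E.
  rewrite (@integral_discrete_sum _ _ _ (P p) _ _ mX _ _ _ (fun nu x =>
      \sum_i (phat_shrink m N r delta x i nu ^+ 2 / p i nu))); last first.
    move=> nu x _; apply: sumr_ge0 => i _.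
    by rewrite divr_ge0 ?sqr_ge0// ltW.
  apply: eq_bigr => nu _.
  rewrite (@integral_discrete_sum _ _ _ (P p) _ _ mX _ _ _ (fun i x =>
      phat_shrink m N r delta x i nu ^+ 2 / p i nu)); last first.
    by move=> i x _; rewrite divr_ge0 ?sqr_ge0// ltW.
  apply: eq_bigr => i _.
  rewrite (integral_sample_div sX (f := fun x => phat_shrink m N r delta x i nu ^+ 2))//.
  (* After the shift, the -1 in the denominator cancels the increment of the column total, and one
     factor x_i + 1 of the square cancels. *)
  - apply: eq_integral => w _; congr EFin.
    rewrite phat_shrinkE incrE col_total_incr total_incr eqxx addn1.
    have c0 := ler0n R (col_total (X w) nu).
    have dw := d0 (total (X w)).+1.
    rewrite -[X in r + X - 1]natr1 [in r + _ - 1]addrA addrK.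
    have x0 : (X w i nu).+1%:R != 0 :> R by rewrite pnatr_eq0.
    move: (_.+1%:R) x0 => u u0; field; rewrite u0/= gt_eqF//; lra.
  - by move=> x; exact: sqr_ge0.
  - by move=> x x0; rewrite phat_shrinkE x0 mul0r expr0n.
rewrite (@integral_discrete_sum _ _ _ (P p) _ _ mX _ _ _ (fun nu x =>
   ((col_total x nu)%:R + m%:R) * (r + (col_total x nu)%:R) /
      (r + (col_total x nu)%:R + delta (total x).+1) ^+ 2)); last first.
  by move=> nu x _; rewrite divr_ge0 ?sqr_ge0// mulr_ge0// addr_ge0// ltW.
apply: eq_bigr => nu _.
rewrite -(@integral_discrete_sum _ _ _ (P p) _ _ mX _ _ _ (fun i x =>
   (x i nu).+1%:R * (r + (col_total x nu)%:R) /
      (r + (col_total x nu)%:R + delta (total x).+1) ^+ 2)); last first.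
  by move=> i x _; exact: q0.
apply: eq_integral => w _; congr EFin.
(* Summing x_i + 1 over i yields x_. + m. *)
rewrite -!mulr_suml; congr (_ * _ * _).
under eq_bigr do rewrite -natr1.
by rewrite big_split/= -natr_sum sumr_const card_ord.
Qed.

End Risk.

(** * Strict risk inequality over the parameter set *)

Lemma DsetN_const (R : realType) (m N : nat) :
  DsetN R m N (const_mx m.+1%:R^-1).
Proof.
move=> nu; split=> [i|]; first by rewrite !mxE invr_gt0 ltr0n.
rewrite (eq_bigr (fun=> m.+1%:R^-1)); last by move=> i _; rewrite !mxE.
by rewrite sumr_const card_ord -[_ *+ _]mulr_natl ltr_pdivrMr ?ltr0n// mul1r ltr_nat.
Qed.

Theorem theorem2p1 (R : realType) (m N n : nat) (r : R) (delta : nat -> R)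
    (d : measure_display) (Omega : measurableType d)
    (P : 'M[R]_(m, N) -> probability Omega R)
    (X : Omega -> 'M[nat]_(m, N))
    (hm : (1 <= m)%N) (hN : (1 <= N)%N) (hn : (1 <= n <= N)%N)
    (hr : 5%:R / 2%:R <= r)
    (hX : forall p : 'M[R]_(m, N), DsetN R m N p -> NM_sample (P p) r p X)
    (hdelta : forall z : nat, 0 < delta z)
    (h_i : forall z : nat, (1 <= z)%N ->
       z%:R * delta z <= (z.+1)%:R * delta z.+1)
    (h_ii : forall z : nat, (2 <= z)%N ->
       (delta z <= 2%:R * (m%:R - 3%:R) ->
          0 <= (m%:R - 6%:R) * delta z + 2%:R * (m%:R - 3%:R) * r) /\
       (2%:R * (m%:R - 3%:R) < delta z ->
          (z%:R - 1) * (delta z - 2%:R * (m%:R - 3%:R)) <=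
          n%:R * ((m%:R - 6%:R) * delta z + 2%:R * (m%:R - 3%:R) * r))) :
  dominates P X (loss m N n) (phat_shrink m N r delta) (phat_U m N r).
Proof.
(* Strictness is proved at every p; the constant 1 / (m + 1), with column sums m / (m + 1) < 1, then
   serves as the required witness. *)
suff lt_risk p : DsetN R m N p -> (risk P X (loss m N n) (phat_shrink m N r delta) p <
    risk P X (loss m N n) (phat_U m N r) p)%E.
  split=> [p /lt_risk/ltW//|].
  by exists (const_mx m.+1%:R^-1); [|apply: lt_risk]; exact: DsetN_const.
move=> Dp; rewrite phat_UE; have sX := hX p Dp; have mX := sample_measurable sX.
have nN : (n <= N)%N by case/andP: hn.
have r1 : 1 < r by lra.
have r0 : 0 < r by lra.
have d0 z : 0 <= delta z by exact: ltW.
pose one := \sum_(nu < N | (nu < n)%N) (1 : R).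
pose S e (x : 'M[nat]_(m, N)) := 2%:R * sum_phat n r e x.
have S_bounds e x : (forall z, 0 <= e z) -> 0 <= S e x <= 2%:R * one.
  move=> e0; have /andP[s0 s1] := sum_phat_bounds n x r1 e0.
  by rewrite /S mulr_ge0// ler_pM2l.
have S_ge0 e x : (forall z, 0 <= e z) -> 0 <= S e x.
  by move=> /(S_bounds _ x)/andP[].
(* The cross terms are exchanged between the two estimators, so that both integrands stay
   nonnegative. *)
pose g x := shifted_square n r delta x + S (fun=> 0) x.
pose h x := shifted_square n r (fun=> 0) x + S delta x.
have gh x : g x <= h x.
  have [tx|] := posnP (total x); last exact: shifted_square_le.
  exact/ltW/shifted_square_total0_lt.
have gh0 : g 0 < h 0.
  apply: shifted_square_total0_lt => //.
  by apply: big1 => nu _; apply: big1 => i _; rewrite mxE.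
pose c := \sum_(nu < N | (nu < n)%N) (m%:R + 1 : R).
have gh_int : (\int[P p]_w (g (X w))%:E < \int[P p]_w (h (X w))%:E)%E.
  apply: (@integral_discrete_lt _ _ _ (P p) _ _ mX g h (c + 2%:R * one) 0) => //.
  - by move=> x; rewrite addr_ge0 ?shifted_square_ge0 ?S_ge0.
  - move=> x; rewrite gh/=; apply: lerD; first exact: shifted_square0_le.
    by have /andP[] := S_bounds delta x d0.
  - by rewrite (sample_law sX) lte_fin (sample_pmf0_gt0 sX).
rewrite !(@integral_discreteD _ _ _ (P p) _ _ mX) in gh_int;
  try by [move=> x; exact: shifted_square_ge0 | move=> x; exact: S_ge0].
have S_fin e : (forall z, 0 <= e z) -> (\int[P p]_w (S e (X w))%:E)%E \is a fin_num.
  by move=> e0; apply: (integral_discrete_fin_num _ mX) => x; exact: S_bounds.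
have risk_S e : (forall z, 0 <= e z) ->
    (risk P X (loss m N n) (phat_shrink m N r e) p + \int[P p]_w (S e (X w))%:E =
     \int[P p]_w (shifted_square n r e (X w))%:E +
       (\sum_(nu < N | (nu < n)%N) \sum_i p i nu)%:E)%E by exact: risk_shrinkD.
have K_fin : (\int[P p]_w (S delta (X w))%:E +
    \int[P p]_w (S (fun=> 0) (X w))%:E)%E \is a fin_num.
  by rewrite fin_numD !S_fin.
(* Adding both finite cross-term integrals to each side turns the comparison of risks into [gh_int]
   plus the common finite sum of the p_i. *)
rewrite -(lteD2rE _ _ K_fin).
rewrite addeA risk_S// [X in (_ < _ + X)%E]addeC [ltRHS]addeA risk_S//.
by rewrite addeAC [ltRHS]addeAC lteD2rE.
Qed.
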